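(* For all positive integers $n\ge 2$ and $r>s$, $R'(n;r,s)=A_{n-1}(r,s)+1$. Equivalently, the maximum $N$ for which there exists an $(r,s)$-coloring of $K_N$ in which, for every color $i\in[r]$, the graph of edges whose color set contains $i$ is $(n-1)$-partite, equals the maximum size of a $q$-ary code with $q=n-1$, length $r$ and distance $s$.
   Context: An $(r,s)$-coloring of $K_N$ is a map $\chi:E(K_N)\to\binom{[r]}{s}$. For color $i$, the color class of $i$ is the graph on $V(K_N)$ whose edges are those $e$ with $i\in\chi(e)$. $R'(n;r,s)$ is the minimum $N$ such that in every $(r,s)$-coloring of $K_N$ there is a color $i$ whose color class has chromatic number at least $n$. For positive integers $q,m,d$, $A_q(m,d)$ is the maximum size of a code $C\subseteq[q]^m$ in which any two distinct codewords differ in at least $d$ coordinates (a $q$-ary code of length $m$ and distance $d$). *)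

(* Defs.v *)
From mathcomp Require Import all_boot.

Set Implicit Arguments.
Unset Strict Implicit.
Unset Printing Implicit Defensive.

Definition is_minimum (P : nat -> Prop) (N : nat) : Prop :=
  P N /\ forall M, P M -> N <= M.

Definition is_maximum (P : nat -> Prop) (N : nat) : Prop :=
  P N /\ forall M, P M -> M <= N.

Structure sgraph (V : finType) := SGraph {
  adj :> rel V;
  adj_sym : symmetric adj;
  adj_irr : irreflexive adj
}.

Definition colorable (V : finType) (G : sgraph V) (k : nat) : bool :=
  [exists f : {ffun V -> 'I_k}, [forall u, forall v, G u v ==> (f u != f v)]].

Lemma colorable_exists (V : finType) (G : sgraph V) : exists k, colorable G k.
Proof.
exists #|V|; apply/existsP; exists [ffun v => enum_rank v].
apply/forallP=> u; apply/forallP=> v; apply/implyP; rewrite !ffunE.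
by apply: contraTN => /eqP/enum_rank_inj ->; rewrite adj_irr.
Qed.

Definition chromatic_number (V : finType) (G : sgraph V) : nat :=
  ex_minn (colorable_exists G).

(* Parts may be empty. *)
Definition partite (V : finType) (G : sgraph V) (k : nat) : Prop :=
  exists P : 'I_k -> {set V},
    [/\ forall v, exists j, v \in P j,
        forall i j, i != j -> [disjoint P i & P j]
      & forall j u v, u \in P j -> v \in P j -> ~~ G u v].

(* The edges of K_N are the 2-element subsets of 'I_N; the values of chi on
   other subsets are never used. *)
Definition is_coloring (N r s : nat) (chi : {set 'I_N} -> {set 'I_r}) : Prop :=
  forall e : {set 'I_N}, #|e| = 2 -> #|chi e| = s.

Section ColorClass.
Variables (N r : nat) (chi : {set 'I_N} -> {set 'I_r}) (i : 'I_r).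

Definition color_adj : rel 'I_N :=
  fun u v => (u != v) && (i \in chi [set u; v]).

Lemma color_adj_sym : symmetric color_adj.
Proof. by move=> u v; rewrite /color_adj eq_sym setUC. Qed.

Lemma color_adj_irr : irreflexive color_adj.
Proof. by move=> u; rewrite /color_adj eqxx. Qed.

Definition color_class : sgraph 'I_N := SGraph color_adj_sym color_adj_irr.

End ColorClass.

Definition chromatic_ramsey_property (n r s N : nat) : Prop :=
  forall chi : {set 'I_N} -> {set 'I_r}, is_coloring s chi ->
    exists i : 'I_r, n <= chromatic_number (color_class chi i).

(* "R'(n; r, s) = N". *)
Definition is_chromatic_ramsey_number (n r s N : nat) : Prop :=
  is_minimum (chromatic_ramsey_property n r s) N.

Definition has_partite_coloring (n r s N : nat) : Prop :=
  exists chi : {set 'I_N} -> {set 'I_r},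
    is_coloring s chi /\ forall i : 'I_r, partite (color_class chi i) n.-1.

Definition hamming_dist (q m : nat) (x y : {ffun 'I_m -> 'I_q}) : nat :=
  #|[set j | x j != y j]|.

Definition is_code (q m d : nat) (C : {set {ffun 'I_m -> 'I_q}}) : bool :=
  [forall x in C, forall y in C, (x != y) ==> (d <= hamming_dist x y)].

(* A_q(m, d). *)
Definition max_code_size (q m d : nat) : nat :=
  \max_(C : {set {ffun 'I_m -> 'I_q}} | is_code d C) #|C|.

(* Main.v *)
(* Proper q-colorings f_i of all the color classes assign to each vertex v the
   word (f_i(v))_i.  An edge uv has s colors, and the words of u and v differ at
   each of them, so the words form a code of distance s (and are distinct, as
   s > 0).  Conversely, index the vertices by codewords and let the color set of
   uv consist of s coordinates at which the two words differ: the i-th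
   coordinate is then a proper coloring of the i-th color class. *)
Require Import Defs.
From mathcomp Require Import all_boot.

Lemma colorable_leq (V : finType) (G : sgraph V) (k l : nat) :
  k <= l -> colorable G k -> colorable G l.
Proof.
move=> le_kl /existsP[f /forallP fP]; apply/existsP.
exists [ffun v => widen_ord le_kl (f v)].
apply/forallP=> u; apply/forallP=> v; rewrite !ffunE.
exact: (forallP (fP u) v).
Qed.

Lemma chromatic_number_leq (V : finType) (G : sgraph V) (k : nat) :
  (chromatic_number G <= k) = colorable G k.
Proof.
rewrite /chromatic_number; case: ex_minnP => m Gm min_m.
by apply/idP/idP => [le_mk|/min_m//]; apply: colorable_leq Gm.
Qed.

Lemma colorableP (V : finType) (G : sgraph V) (k : nat) :
  reflect (exists f : {ffun V -> 'I_k}, forall u v, G u v -> f u != f v)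
          (colorable G k).
Proof.
apply: (iffP existsP) => -[f fP]; exists f.
  by move=> u v; apply/implyP; exact: (forallP (forallP fP u) v).
by apply/forallP=> u; apply/forallP=> v; apply/implyP/fP.
Qed.

(** Color each vertex by a part containing it; conversely, the fibers of a proper coloring are the
    parts. *)
Lemma partite_colorable (V : finType) (G : sgraph V) (k : nat) :
  partite G k <-> colorable G k.
Proof.
split=> [[P [P_cover _ P_indep]]|/colorableP[f fP]].
  apply/colorableP; exists [ffun v => xchoose (P_cover v)] => u v Guv.
  rewrite !ffunE; apply: contraL Guv => /eqP eq_uv.
  apply: P_indep (xchooseP (P_cover u)) _.
  by rewrite eq_uv; exact: xchooseP (P_cover v).
exists (fun j => [set v | f v == j]); split=> [v|i j neq_ij|j u v].
- by exists (f v); rewrite inE.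
- rewrite disjoint_subset; apply/subsetP=> v.
  by rewrite !inE => /eqP ->.
- rewrite !inE => /eqP fu /eqP fv.
  by apply/negP=> /fP; rewrite fu fv eqxx.
Qed.

Lemma colorable_classes_code (q r s N : nat)
    (chi : {set 'I_N} -> {set 'I_r}) :
  0 < s -> is_coloring s chi ->
  (forall i, colorable (color_class chi i) q) -> N <= max_code_size q r s.
Proof.
move=> s_gt0 chi_s col.
(* The boolean form of properness lets [xchoose] pick one coloring for every [i] at once. *)
have f_ex i : exists f : {ffun 'I_N -> 'I_q},
    [forall u, forall v, color_class chi i u v ==> (f u != f v)].
  exact/existsP/col.
pose f i := xchoose (f_ex i).
have fP i u v : color_class chi i u v -> f i u != f i v.
  by apply/implyP; exact: (forallP (forallP (xchooseP (f_ex i)) u) v).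
pose w (v : 'I_N) : {ffun 'I_r -> 'I_q} := [ffun i => f i v].
have w_dist u v : u != v -> s <= hamming_dist (w u) (w v).
  move=> neq_uv; have /chi_s <- : #|[set u; v]| = 2 by rewrite cards2 neq_uv.
  apply/subset_leq_card/subsetP=> i chi_i; rewrite inE !ffunE.
  by apply: fP; rewrite /= /color_adj neq_uv.
(* Equal words are at distance 0, which is less than [s]. Hence the image of [w] has exactly [N]
   codewords. *)
have w_inj : injective w.
  move=> u v eq_w; apply/eqP; apply: contraTT s_gt0 => /w_dist.
  rewrite eq_w /hamming_dist -leqNgt => /leq_trans; apply.
  by rewrite leqn0 cards_eq0; apply/eqP/setP=> i; rewrite !inE eqxx.
rewrite -[leqLHS]card_ord -(card_imset _ w_inj).
apply: (leq_bigmax_cond [set w v | v : 'I_N]).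
apply/forallP=> x; apply/implyP=> /imsetP[u _ ->].
apply/forallP=> y; apply/implyP=> /imsetP[v _ ->].
by apply/implyP=> neq_w; apply: w_dist; apply: contraNneq neq_w => ->.
Qed.

Lemma code_colorable_classes (q r s N : nat) :
  N <= max_code_size q r s ->
  exists chi : {set 'I_N} -> {set 'I_r},
    is_coloring s chi /\ forall i, colorable (color_class chi i) q.
Proof.
(* The empty code shows that the maximum ranges over a nonempty family, so some code [C] attains
   it. *)
have code0 : is_code s (set0 : {set {ffun 'I_r -> 'I_q}}).
  by apply/forallP=> x; rewrite inE.
rewrite /max_code_size (bigmax_eq_arg set0) //.
case: arg_maxnP => // C codeC _ le_NC.
pose w (v : 'I_N) := enum_val (widen_ord le_NC v).
have w_inj : injective w.
  by move=> u v /enum_val_inj/(congr1 val) eq_uv; apply: val_inj.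
(* A coloring takes an unordered edge, so the set of differing coordinates is defined symmetrically
   from [e]. *)
pose D (e : {set 'I_N}) :=
  [set i | [exists u in e, exists v in e, w u i != w v i]].
have D2 u v i : (i \in D [set u; v]) = (w u i != w v i).
  rewrite inE; apply/exists_inP/idP => [[x xuv /exists_inP[y yuv]]|neq_w].
    by case/set2P: xuv => ->; case/set2P: yuv => ->; rewrite ?eqxx // eq_sym.
  by exists u; rewrite ?set21 //; apply/exists_inP; exists v; rewrite ?set22.
(* Keeping the first [s] elements of [D e] gives exactly [s] colors, because the distance of [C]
   ensures that [D e] has at least [s] elements when [e] is an edge. *)
exists (fun e => [set i in take s (enum (D e))]); split=> [e /eqP/cards2P|i].
  case=> u [v [neq_uv ->]]; rewrite cardsE.
  rewrite (card_uniqP (take_uniq _ (enum_uniq _))) size_takel // -cardE.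
  have/forall_inP/(_ _ (enum_valP (widen_ord le_NC u))) := codeC.
  move/forall_inP/(_ _ (enum_valP (widen_ord le_NC v))).
  rewrite (inj_eq w_inj) neq_uv => /leq_trans; apply.
  by apply/subset_leq_card/subsetP=> j; rewrite D2 inE.
apply/colorableP; exists [ffun v => w v i] => u v /andP[_].
by rewrite !ffunE -D2 inE => /mem_take; rewrite mem_enum.
Qed.

Lemma has_partite_coloringE (n r s N : nat) :
  0 < s -> has_partite_coloring n r s N <-> N <= max_code_size n.-1 r s.
Proof.
move=> s_gt0; split=> [[chi [chi_s part]]|].
  apply: (colorable_classes_code _ _ _ _ _ s_gt0 chi_s) => i.
  exact/partite_colorable.
move=> /code_colorable_classes[chi [chi_s col]].
by exists chi; split=> // i; apply/partite_colorable.
Qed.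

(** The property fails exactly when some coloring has all its classes [n.-1]-colorable; [0 < n]
    turns chromatic number at least [n] into the failure of [n.-1]-colorability. *)
Lemma chromatic_ramsey_propertyE (n r s N : nat) :
  0 < n -> 0 < s ->
  chromatic_ramsey_property n r s N <-> max_code_size n.-1 r s < N.
Proof.
move=> n_gt0 s_gt0.
have leq_chi (V : finType) (G : sgraph V) :
    (n <= chromatic_number G) = ~~ colorable G n.-1.
  by rewrite -chromatic_number_leq -ltnNge prednK.
split=> [ramsey|lt_N chi chi_s].
  rewrite ltnNge; apply/negP=> /code_colorable_classes[chi [chi_s col]].
  by have [i] := ramsey chi chi_s; rewrite leq_chi col.
have [/existsP[i]|] := boolP [exists i, ~~ colorable (color_class chi i) n.-1].
  by rewrite -leq_chi; exists i.
rewrite negb_exists => /forallP col; move: lt_N; rewrite ltnNge.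
rewrite (colorable_classes_code _ _ _ _ _ s_gt0 chi_s) // => i.
by rewrite -[colorable _ _]negbK.
Qed.

Theorem theorem4p2 (n r s : nat) (hn : 2 <= n) (hs : 0 < s) (hrs : s < r) :
  is_chromatic_ramsey_number n r s (max_code_size n.-1 r s + 1) /\
  is_maximum (has_partite_coloring n r s) (max_code_size n.-1 r s).
Proof.
have n_gt0 : 0 < n by apply: ltnW.
(* Both extremal values are read off from threshold equivalences at the same bound. *)
rewrite addn1; split; split=> [|M].
- exact/chromatic_ramsey_propertyE.
- by move/chromatic_ramsey_propertyE; apply.
- exact/has_partite_coloringE.
- by move/has_partite_coloringE; apply.
Qed.
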